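(* Let $Q\subset\mathbb{R}^d$ be a nonempty compact convex set, let $L_0,L_1>0$, and let $f:\mathbb{R}^d\to\mathbb{R}$ be a convex $(L_0,L_1)$-smooth function. Let $x^*\in\arg\min_{x\in Q}f(x)$, let $D=\max_{x,y\in Q}\|x-y\|$, and let $x_0,x_1,\dots,x_N$ be generated by $N\ge1$ iterations of the $(L_0,L_1)$-Frank--Wolfe algorithm with parameters $L_0,L_1$ from a starting point $x_0\in Q$. Then for every $k$ with $1\le k\le N$, $$f(x_k)-f(x^* )\le\frac{2eD^2\left(L_0+L_1\max_{0\le i\le N}\|\nabla f(x_i)\|\right)}{k+3}.$$
   Context: $\|\cdot\|$ is the Euclidean norm; $e=\exp(1)$. $(L_0,L_1)$-smoothness: a differentiable $f:\mathbb{R}^d\to\mathbb{R}$ is $(L_0,L_1)$-smooth ($L_0,L_1>0$) if for all $x,y\in\mathbb{R}^d$ with $\|x-y\|\le 1/L_1$ one has $\|\nabla f(x)-\nabla f(y)\|\le (L_0+L_1\|\nabla f(y)\|)\|x-y\|$. $(L_0,L_1)$-Frank--Wolfe algorithm: for $k=0,1,\dots,N-1$, choose any $s_k\in\arg\min_{z\in Q}\nabla f(x_k)^\top z$, set $d_k=s_k-x_k$, $$\alpha_k=\min\left\{1,\ \frac{-\nabla f(x_k)^\top d_k}{(L_0+L_1\|\nabla f(x_k)\|)\,\|d_k\|^2\,e}\right\},\qquad x_{k+1}=x_k+\alpha_kd_k,$$ with the convention $\alpha_k=1$ (so $x_{k+1}=x_k$) if $d_k=0$. *)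

(* Defs.v *)
From HB Require Import structures.
From mathcomp Require Import all_boot all_order all_algebra.
From mathcomp Require Import all_classical all_reals all_analysis.
Import Order.TTheory GRing.Theory Num.Theory.
Import numFieldNormedType.Exports.

Set Implicit Arguments.
Unset Strict Implicit.
Unset Printing Implicit Defensive.

Local Open Scope classical_set_scope.
Local Open Scope ring_scope.

Definition dotv (R : realType) (d : nat) (u v : 'rV[R]_d) : R :=
  \sum_(i < d) u 0 i * v 0 i.

(* The library norm [`|u|] on ['rV[R]_d] is the sup norm. Compactness and
   differentiability do not depend on which of the two norms is used. *)
Definition enorm (R : realType) (d : nat) (u : 'rV[R]_d) : R :=
  Num.sqrt (\sum_(i < d) u 0 i ^+ 2).

Definition grad (R : realType) (d : nat) (f : 'rV[R]_d -> R) (x : 'rV[R]_d) :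
    'rV[R]_d :=
  \row_(i < d) 'D_(delta_mx 0 i) f x.

Definition argmin (R : realType) (T : Type) (Q : set T) (g : T -> R) : set T :=
  [set x | Q x /\ forall z, Q z -> g x <= g z].

Definition is_max (R : realType) (A : set R) (m : R) : Prop :=
  A m /\ ubound A m.

Definition L0L1_smooth (R : realType) (d : nat) (L0 L1 : R)
    (f : 'rV[R]_d -> R) : Prop :=
  (forall x, differentiable f x) /\
  (forall x y, enorm (x - y) <= 1 / L1 ->
     enorm (grad f x - grad f y)
       <= (L0 + L1 * enorm (grad f y)) * enorm (x - y)).

Definition fw_step_size (R : realType) (d : nat) (L0 L1 : R)
    (f : 'rV[R]_d -> R) (x v : 'rV[R]_d) : R :=
  if v == 0 then 1
  else Num.min 1
    (- dotv (grad f x) v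
       / ((L0 + L1 * enorm (grad f x)) * enorm v ^+ 2 * expR 1)).

(* [x] and [s] are the iterates and the chosen minimizers; only the values
   [x 0, ..., x N] and [s 0, ..., s (N - 1)] are constrained. *)
Definition frank_wolfe (R : realType) (d : nat) (L0 L1 : R)
    (Q : set 'rV[R]_d) (f : 'rV[R]_d -> R) (N : nat)
    (x s : nat -> 'rV[R]_d) : Prop :=
  forall k, (k < N)%N ->
    argmin Q (fun z => dotv (grad f (x k)) z) (s k) /\
    x k.+1 = x k + fw_step_size L0 L1 f (x k) (s k - x k) *: (s k - x k).

(* Main.v *)
Require Import Defs.
From HB Require Import structures.
From mathcomp Require Import all_boot all_order all_algebra.
From mathcomp Require Import all_classical all_reals all_analysis.
From mathcomp Require Import ring lra.
Import Order.TTheory GRing.Theory Num.Theory.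
Import numFieldNormedType.Exports.

Local Open Scope classical_set_scope.
Local Open Scope ring_scope.

(** The step size is the minimizer over [0, 1] of a quadratic that bounds the
    change of [f] along the Frank-Wolfe direction, so one iteration does at least
    as well as any other step in [0, 1]; comparing with the classical step
    2 / (k + 3) gives the rate.

    Write g for the gradient at the iterate [x k], a for L0 + L1 |g|, v for the
    direction [s k - x k] and G = - g.v for the Frank-Wolfe gap. Smoothness holds
    only at distance at most 1 / L1, so the quadratic bound
    f(x + w) <= f(x) + g.w + (a / 2) |w|^2 is available only for such
    displacements w ([L0L1_smooth_descent]). The chosen step gamma is always
    short enough: if v is nonzero, then gamma <= G / (a |v|^2 e), and
    Cauchy-Schwarz gives G <= |g| |v|, hence gamma |v| <= |g| / (a e) <= 1 / L1,
    because L1 |g| <= a.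

    Moreover gamma minimizes - t G + (e a |v|^2 / 2) t^2 over [0, 1]
    ([min1_div_minimizes_quadratic]). As e >= 1, weakening a to e a in the
    quadratic bound gives, for every t in [0, 1],
    f(x k.+1) <= f(x k) - t G + (e a D^2 / 2) t^2 ([fw_step_progress]). By
    convexity and the choice of [s k], G is at least the primal gap
    delta_k = f(x k) - f(xstar), so with B = e D^2 (L0 + L1 max |grad f(x i)|)
    delta_(k+1) <= (1 - t) delta_k + (B / 2) t^2   for all t in [0, 1].
    Taking t = 1 at k = 0 and t = 2 / (k + 3) afterwards yields
    delta_k <= 2 B / (k + 3) for k >= 1 ([frank_wolfe_rate]). *)

(** * The Euclidean norm and inner product *)

Section EuclideanStructure.
Context {R : realType} {d : nat}.
Implicit Types u v w : 'rV[R]_d.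

Lemma dotvBl u v w : dotv (u - v) w = dotv u w - dotv v w.
Proof.
by rewrite /dotv -sumrB; apply: eq_bigr => i _; rewrite !mxE mulrBl.
Qed.

Lemma dotvBr u v w : dotv u (v - w) = dotv u v - dotv u w.
Proof.
by rewrite /dotv -sumrB; apply: eq_bigr => i _; rewrite !mxE mulrBr.
Qed.

Lemma dotvZr a u v : dotv u (a *: v) = a * dotv u v.
Proof.
by rewrite /dotv mulr_sumr; apply: eq_bigr => i _; rewrite !mxE mulrCA.
Qed.

Lemma enorm_ge0 u : 0 <= enorm u.
Proof. exact: sqrtr_ge0. Qed.

Lemma enorm_sqr u : enorm u ^+ 2 = \sum_(i < d) u 0 i ^+ 2.
Proof. by rewrite sqr_sqrtr// sumr_ge0// => i _; rewrite sqr_ge0. Qed.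

Lemma enorm_eq0 u : (enorm u == 0) = (u == 0).
Proof.
apply/eqP/eqP => [u0|->]; last first.
  by rewrite /enorm big1 ?sqrtr0// => i _; rewrite mxE expr0n.
have: \sum_(i < d) u 0 i ^+ 2 == 0 by rewrite -enorm_sqr u0 expr0n.
rewrite psumr_eq0 => [/allP ui0|i _]; last exact: sqr_ge0.
apply/rowP => i; rewrite mxE; apply/eqP; rewrite -sqrf_eq0.
exact: ui0 (mem_index_enum i).
Qed.

Lemma enormZ a u : enorm (a *: u) = `|a| * enorm u.
Proof.
rewrite /enorm -sqrtr_sqr -sqrtrM ?sqr_ge0// mulr_sumr.
by congr (Num.sqrt _); apply: eq_bigr => i _; rewrite mxE exprMn.
Qed.

Lemma enorm_sqr_comb (a b : R) u v :
  enorm (a *: u - b *: v) ^+ 2 =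
    a ^+ 2 * enorm u ^+ 2 - 2 * a * b * dotv u v + b ^+ 2 * enorm v ^+ 2.
Proof.
rewrite !enorm_sqr /dotv !mulr_sumr -sumrB -big_split/=.
by apply: eq_bigr => i _; rewrite !mxE; ring.
Qed.

(** Cauchy-Schwarz: |v|^2 times the defect |u|^2 |v|^2 - (u.v)^2 is the squared
    norm of |v|^2 u - (u.v) v, a multiple of the component of u orthogonal
    to v. *)
Lemma ler_dotv u v : dotv u v <= enorm u * enorm v.
Proof.
have [->|v_neq0] := eqVneq v 0.
  rewrite (_ : dotv u 0 = 0) ?mulr_ge0 ?enorm_ge0//.
  by rewrite /dotv big1// => i _; rewrite mxE mulr0.
have v_gt0 : 0 < enorm v by rewrite lt_neqAle eq_sym enorm_eq0 v_neq0 enorm_ge0.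
have := sqr_ge0 (enorm (enorm v ^+ 2 *: u - dotv u v *: v)).
rewrite enorm_sqr_comb (_ : _ + _ =
    enorm v ^+ 2 * ((enorm u * enorm v) ^+ 2 - dotv u v ^+ 2)); last by ring.
rewrite pmulr_rge0 ?exprn_gt0// subr_ge0.
move: (mulr_ge0 (enorm_ge0 u) (ltW v_gt0)).
move: (enorm u * enorm v) (dotv u v) => p q p_ge0 /(ler_wsqrtr).
by rewrite !sqrtr_sqr (ger0_norm p_ge0); exact/le_trans/ler_norm.
Qed.
End EuclideanStructure.

(** * Gradients, convexity and the descent inequality *)

Section Gradient.
Context {R : realType} {d : nat}.
Implicit Types (f : 'rV[R]_d -> R) (x y v : 'rV[R]_d).

Lemma derive_dotv_grad f x v : differentiable f x ->
  'D_v f x = dotv (grad f x) v.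
Proof.
move=> df; rewrite deriveE// [in LHS](row_sum_delta v) linear_sum/=.
by apply: eq_bigr => i _; rewrite linearZ/= mxE deriveE// mulrC.
Qed.

(** The difference quotient of [fun h => f (x + h *: v)] at [t] is the one defining
    the directional derivative of [f] at [x + t *: v], so no chain rule is used. *)
Lemma is_derive_line f x v (t : R) : (forall y, differentiable f y) ->
  is_derive t 1 (fun h => f (x + h *: v)) (dotv (grad f (x + t *: v)) v).
Proof.
move=> df.
have E : (fun h : R => h^-1 *: (((fun h => f (x + h *: v)) \o shift t) (h *: 1)
      - f (x + t *: v))) =
    (fun h : R => h^-1 *: ((f \o shift (x + t *: v)) (h *: v)
      - f (x + t *: v))).
  apply/funext => h /=; congr (_ *: (f _ - _)).
  by rewrite /= scalerDl [h *: 1]mulr1 addrCA.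
split; last rewrite -derive_dotv_grad//.
  by rewrite /derivable E; exact: diff_derivable.
by rewrite /derive E.
Qed.

(** A convex function lies above its tangents: for 0 < h <= 1 convexity bounds the
    difference quotient (f(x + h (y - x)) - f(x)) / h by f(y) - f(x), and the
    left-hand side is its limit as h decreases to 0. *)
Lemma convex_grad_le f x y : differentiable f x -> convex_function setT f ->
  dotv (grad f x) (y - x) <= f y - f x.
Proof.
move=> df cf; rewrite -derive_dotv_grad//.
have := cvg_dnbhs_at_right (diff_derivable (v := y - x) df).
move=> /cvgr_to_le; apply.
near=> h.
have h_gt0 : 0 < h by [].
have h_le1 : h <= 1 by near: h; exact: nbhs_right_le.
have := cf (Itv01 (ltW h_gt0) h_le1) y x (in_setT _) (in_setT _).
rewrite convRE /= => fh.
have -> : h *: (y - x) + x = h *: y + (1 - h) *: x.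
  by rewrite scalerBr scalerBl scale1r addrAC addrA.
rewrite [_ *: _]mulrC ler_pdivrMr//.
move: fh; rewrite /conv/= /unstable.onem => fh.
by rewrite lerBlDr; apply: le_trans fh _; lra.
Unshelve. all: by end_near.
Qed.

(** Along the segment from [x] to [x + v] all points are within 1 / L1 of [x], so
    the gradient deviates from its value at [x] by at most a t |v|, where
    a = L0 + L1 |grad f x|. Hence [psi], which up to a constant is the
    excess of [f] over its quadratic upper model, has a nonpositive derivative
    on [0, 1]. *)
Lemma L0L1_smooth_descent f L0 L1 x v : L0L1_smooth L0 L1 f ->
  0 <= L0 + L1 * enorm (grad f x) -> enorm v <= 1 / L1 ->
  f (x + v) <= f x + dotv (grad f x) v
               + (L0 + L1 * enorm (grad f x)) / 2 * enorm v ^+ 2.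
Proof.
move=> [df lip]; set a := L0 + _ => a_ge0 v_small.
pose psi (t : R) := f (x + t *: v) - t * dotv (grad f x) v
                    - t ^+ 2 * (a / 2 * enorm v ^+ 2).
have dpsi (t : R) : is_derive t 1 psi
    (dotv (grad f (x + t *: v) - grad f x) v - a * t * enorm v ^+ 2).
  have := is_derive_line f x v t df => df_line.
  rewrite /psi; apply: is_derive_eq.
  rewrite !scaler0 !add0r dotvBl ![_%:A]mulr1.
  rewrite (_ : _ *: (t + t) = a / 2 * enorm v ^+ 2 * (t + t)) //.
  by field.
have : psi 1 <= psi 0.
  apply: (@ler0_derive1_nincr _ psi 0 1) => //.
  - move=> t t01; rewrite derive1E derive_val.
    move: t01; rewrite in_itv/= => /andP[t_gt0 t_lt1].
    rewrite subr_le0; apply: le_trans (ler_dotv _ _) _.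
    rewrite expr2 mulrA ler_wpM2r ?enorm_ge0//.
    have := lip (x + t *: v) x; rewrite (addrC x) addrK enormZ gtr0_norm//.
    rewrite mulrA; apply; apply: le_trans v_small.
    by rewrite ler_piMl ?enorm_ge0// ltW.
  - by apply: derivable_within_continuous.
rewrite /psi scale1r scale0r addr0.
lra.
Qed.
End Gradient.

(** * One-dimensional estimates *)

Section StepAndRate.
Context {R : realType}.

(** The vertex of the parabola - t G + (C / 2) t^2 is G / C. If it is at least 1 the
    parabola decreases on [0, 1] and 1 is the best choice there; otherwise the
    vertex itself is at least as good as any [t]. *)
Lemma min1_div_minimizes_quadratic (G C t : R) : 0 < C -> 0 <= t <= 1 ->
  - (Num.min 1 (G / C) * G) + C / 2 * Num.min 1 (G / C) ^+ 2
    <= - (t * G) + C / 2 * t ^+ 2.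
Proof.
move=> C_gt0 /andP[t_ge0 t_le1].
rewrite minEle; case: ifP => [|_].
  rewrite ler_pdivlMr// => CG.
  have := mulr_ge0 (ltW C_gt0) (sqr_ge0 (1 - t)).
  have : 0 <= (1 - t) * (G - C) by apply: mulr_ge0; lra.
  lra.
have := divfK (lt0r_neq0 C_gt0) G; set b := G / C => <-.
have := mulr_ge0 (ltW C_gt0) (sqr_ge0 (t - b)).
lra.
Qed.

(** The free parameter [t] is set to 1 at the first step, which forgets [delta 0]
    altogether, and to 2 / (c + 3) at each later step c; the induction then
    closes by (c + 2) (c + 4) <= (c + 3)^2. *)
Lemma frank_wolfe_rate (N : nat) (B : R) (delta : nat -> R) : 0 <= B ->
  (forall k (t : R), (k < N)%N -> 0 <= t <= 1 ->
     delta k.+1 <= (1 - t) * delta k + B / 2 * t ^+ 2) ->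
  forall k, (1 <= k <= N)%N -> delta k <= 2 * B / (k%:R + 3).
Proof.
move=> B_ge0 rec; elim=> // -[|k] IH /andP[_ kN].
  have := rec 0%N 1 kN; rewrite ler01 lexx => /(_ isT).
  rewrite subrr mul0r add0r expr1n mulr1 => /le_trans; apply.
  by rewrite (_ : 2 * B / _ = B / 2)//; field.
have k3_gt0 : 0 < k.+1%:R + 3 :> R by rewrite ltr_wpDl.
have t01 : 0 <= 2 / (k.+1%:R + 3 : R) <= 1.
  apply/andP; split; first by rewrite divr_ge0 ?(ltW k3_gt0).
  rewrite ler_pdivrMr// mul1r -natr1.
  by have := ler0n R k; lra.
apply: (le_trans (rec k.+1 _ kN t01)).
have := IH (ltnW kN); move: t01; rewrite -(@natr1 _ k.+1).
move: (k.+1%:R) k3_gt0 => c c3_gt0 /andP[_ t_le1] delta_le.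
(* The induction hypothesis bounds the right-hand side by 2 B times
   (1 - 2 / (c + 3)) / (c + 3) + 1 / (c + 3)^2 = (c + 2) / (c + 3)^2. *)
apply: (@le_trans _ _ (2 * B * ((c + 2) / (c + 3) ^+ 2))).
  rewrite (_ : 2 * B * _ = (1 - 2 / (c + 3)) * (2 * B / (c + 3))
                           + B / 2 * (2 / (c + 3)) ^+ 2).
    by rewrite lerD2r ler_wpM2l// subr_ge0.
  by field; rewrite gt_eqF.
rewrite ler_wpM2l ?mulr_ge0//.
rewrite ler_pdivrMr ?exprn_gt0// mulrC ler_pdivlMr; last by lra.
nra.
Qed.
End StepAndRate.

(** * The Frank-Wolfe step *)

Section FrankWolfe.
Context {R : realType} {d : nat}.
Implicit Types (f : 'rV[R]_d -> R) (x v : 'rV[R]_d).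

Lemma fw_step_size_ge0_le1 L0 L1 f x v : 0 <= L0 + L1 * enorm (grad f x) ->
  dotv (grad f x) v <= 0 -> 0 <= fw_step_size L0 L1 f x v <= 1.
Proof.
move=> a_ge0 gv; rewrite /fw_step_size.
case: eqP => _; first by rewrite ler01 lexx.
rewrite le_min ler01 ge_min lexx /= andbT.
by rewrite divr_ge0 ?oppr_ge0// !mulr_ge0 ?expR_ge0 ?enorm_ge0.
Qed.

(** The step actually taken is compared with an arbitrary [t] in [0, 1]. The factor
    e of the step size is lost here: the true curvature constant is
    L0 + L1 |grad f x|, and only the larger one, multiplied by e, is minimized
    by the chosen step. *)
Lemma fw_step_progress f L0 L1 x v D (t : R) : L0L1_smooth L0 L1 f ->
  0 < L0 -> 0 < L1 -> dotv (grad f x) v <= 0 -> enorm v <= D -> 0 <= t <= 1 ->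
  f (x + fw_step_size L0 L1 f x v *: v)
    <= f x + t * dotv (grad f x) v
       + expR 1 * D ^+ 2 * (L0 + L1 * enorm (grad f x)) / 2 * t ^+ 2.
Proof.
move=> fs L0_gt0 L1_gt0 gv_le0 vD t01.
set a := L0 + _.
have a_gt0 : 0 < a by rewrite ltr_wpDr// mulr_ge0 ?enorm_ge0// ltW.
have e_gt1 : 1 < expR 1 :> R by rewrite expR_gt1.
have e_gt0 : 0 < expR 1 :> R by exact: expR_gt0.
have D_ge0 : 0 <= D := le_trans (enorm_ge0 v) vD.
have [t_ge0 _] := andP t01.
have [v0|v_neq0] := eqVneq v 0.
  rewrite v0 scaler0 addr0 (_ : dotv _ 0 = 0); last first.
    by rewrite -(scale0r v) dotvZr mul0r.
  by rewrite mulr0 addr0 lerDl !mulr_ge0 ?invr_ge0// ltW.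
have v_gt0 : 0 < enorm v by rewrite lt_neqAle eq_sym enorm_eq0 v_neq0 enorm_ge0.
have C_gt0 : 0 < a * enorm v ^+ 2 * expR 1 by rewrite !mulr_gt0// exprn_gt0.
have := fw_step_size_ge0_le1 L0 L1 f x v (ltW a_gt0) gv_le0.
rewrite /fw_step_size (negbTE v_neq0) -/a; set gamma := Num.min _ _.
move=> /andP[gamma_ge0 gamma_le1].
(* The step stays in the ball where smoothness applies: Cauchy-Schwarz bounds the
   gap by |grad f x| |v|, and L1 |grad f x| <= a. *)
have small : enorm (gamma *: v) <= 1 / L1.
  rewrite enormZ ger0_norm//.
  have gammaC : gamma * (a * enorm v ^+ 2 * expR 1) <= enorm (grad f x) * enorm v.
    rewrite -ler_pdivlMr//; apply: (@le_trans _ _ (- dotv (grad f x) v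
        / (a * enorm v ^+ 2 * expR 1))); first by rewrite /gamma ge_min lexx orbT.
    rewrite ler_pM2r ?invr_gt0// -mulN1r -dotvZr.
    by apply: le_trans (ler_dotv _ _) _; rewrite enormZ normrN1 mul1r.
  have gammaa : gamma * enorm v * (a * expR 1) <= enorm (grad f x).
    rewrite -(ler_pM2r v_gt0) (_ : _ * enorm v =
      gamma * (a * enorm v ^+ 2 * expR 1))//.
    by ring.
  rewrite ler_pdivlMr// -(ler_pM2r a_gt0) mul1r.
  apply: (@le_trans _ _ (L1 * enorm (grad f x))); last by rewrite /a lerDr ltW.
  rewrite mulrAC [leLHS]mulrC ler_wpM2l ?(ltW L1_gt0)//.
  apply: le_trans gammaa; rewrite mulrA ler_peMr ?(ltW e_gt1)//.
  by rewrite !mulr_ge0 ?enorm_ge0// ltW.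
have := L0L1_smooth_descent f L0 L1 x (gamma *: v) fs (ltW a_gt0) small.
move=> /le_trans; apply; rewrite -/a dotvZr enormZ ger0_norm// -!addrA lerD2l.
have := min1_div_minimizes_quadratic (- dotv (grad f x) v) _ t C_gt0 t01.
rewrite -/gamma !mulrN !opprK => opt.
apply: (@le_trans _ _ (gamma * dotv (grad f x) v
   + a * enorm v ^+ 2 * expR 1 / 2 * gamma ^+ 2)).
  rewrite lerD2l exprMn.
  rewrite (_ : a * _ * _ / 2 * _ = a / 2 * (gamma ^+ 2 * enorm v ^+ 2) * expR 1);
    last by ring.
  by rewrite ler_peMr ?(ltW e_gt1)// !mulr_ge0 ?invr_ge0 ?sqr_ge0// ltW.
apply: le_trans opt _; rewrite lerD2l ler_wpM2r ?sqr_ge0// ler_pM2r ?invr_gt0//.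
rewrite [leLHS]mulrAC [leRHS]mulrC [leRHS]mulrA.
by rewrite ler_pM2l ?mulr_gt0// lerXn2r// nnegrE enorm_ge0.
Qed.

End FrankWolfe.

Theorem theorem3 (R : realType) (d : nat) (Q : set 'rV[R]_d) (L0 L1 : R)
    (f : 'rV[R]_d -> R) (xstar : 'rV[R]_d) (D : R) (N : nat)
    (x s : nat -> 'rV[R]_d)
    (Q_nonempty : Q !=set0)
    (Q_compact : compact Q)
    (Q_convex : convex_set Q)
    (L0_gt0 : 0 < L0)
    (L1_gt0 : 0 < L1)
    (f_convex : convex_function setT f)
    (f_smooth : L0L1_smooth L0 L1 f)
    (xstar_min : argmin Q f xstar)
    (D_max : is_max [set enorm (y - z) | y in Q & z in Q] D)
    (N_ge1 : (1 <= N)%N)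
    (x0_in : Q (x 0%N))
    (x_fw : frank_wolfe L0 L1 Q f N x s) :
  forall k : nat, (1 <= k <= N)%N ->
    f (x k) - f xstar
      <= 2 * expR 1 * D ^+ 2
           * (L0 + L1 * \big[Num.max/0]_(i < N.+1) enorm (grad f (x i)))
         / (k%:R + 3).
Proof.
set M := \big[_/_]_(_ < _) _.
have a_gt0 y : 0 < L0 + L1 * enorm (grad f y).
  by rewrite ltr_wpDr// mulr_ge0 ?enorm_ge0// ltW.
have slope_le0 k : (k < N)%N -> Q (x k) -> dotv (grad f (x k)) (s k - x k) <= 0.
  by move=> kN xkQ; rewrite dotvBr subr_le0; have [[_ +] _] := x_fw k kN; apply.
have xQ k : (k <= N)%N -> Q (x k).
  elim: k => // k IH kN; have xkQ := IH (ltnW kN).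
  have [[skQ _] ->] := x_fw k kN.
  have /andP[g_ge0 g_le1] := fw_step_size_ge0_le1 L0 L1 f (x k) (s k - x k)
    (ltW (a_gt0 _)) (slope_le0 _ kN xkQ).
  have := Q_convex (s k) (x k) (Itv01 g_ge0 g_le1) (mem_set skQ) (mem_set xkQ).
  move=> /set_mem; congr Q; rewrite /conv/= /unstable.onem.
  by rewrite scalerBr scalerBl scale1r addrCA addrA.
have M_ge0 : 0 <= M by exact: bigmax_ge_id.
move=> k kN.
have B_ge0 : 0 <= expR 1 * D ^+ 2 * (L0 + L1 * M).
  apply: mulr_ge0; last by rewrite addr_ge0 ?mulr_ge0// ltW.
  by apply: mulr_ge0; rewrite ?expR_ge0 ?sqr_ge0.
(* The bound is now 2 * B / (k + 3), the shape in which the recurrence is solved. *)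
rewrite -2!(mulrA 2).
apply: (frank_wolfe_rate N _ (fun k => f (x k) - f xstar)) => // {kN} {}k t kN t01.
have xkQ : Q (x k) by exact/xQ/ltnW.
have [[skQ sk_min] ->] := x_fw k kN.
have diam : enorm (s k - x k) <= D.
  by apply: D_max.2; exists (s k) => //; exists (x k).
have := fw_step_progress f L0 L1 (x k) (s k - x k) D t f_smooth L0_gt0 L1_gt0
  (slope_le0 _ kN xkQ) diam t01.
have gap : dotv (grad f (x k)) (s k - x k) <= f xstar - f (x k).
  apply: le_trans (convex_grad_le f (x k) xstar (f_smooth.1 _) f_convex).
  by rewrite !dotvBr lerD2r; exact: sk_min xstar_min.1.
have := ler_wpM2l (andP t01).1 gap.
have : expR 1 * D ^+ 2 * (L0 + L1 * enorm (grad f (x k))) / 2 * t ^+ 2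
    <= expR 1 * D ^+ 2 * (L0 + L1 * M) / 2 * t ^+ 2.
  rewrite ler_wpM2r ?sqr_ge0// ler_wpM2r ?invr_ge0// ler_wpM2l//.
    by apply: mulr_ge0; rewrite ?expR_ge0 ?sqr_ge0.
  rewrite lerD2l ler_wpM2l ?(ltW L1_gt0)//.
  exact: (le_bigmax _ (fun i : 'I_N.+1 => enorm (grad f (x i)))
    (Ordinal (ltnW kN : (k < N.+1)%N))).
lra.
Qed.
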